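(* Let $p$ be a prime, let $A,\Gamma\subset\mathbb{F}_p^*$ be multiplicative subgroups with $|A|<\sqrt p$, and let $C,D\subseteq\mathbb{F}_p^*$ be arbitrary sets. Suppose that for some $\xi,\eta\in\mathbb{F}_p^*$ and $s\in\mathbb{F}_p$ one has $C\subseteq\xi A+s$, $D\subseteq\eta A+s$, $|C|\ge3$, and $$C-D\subseteq\Gamma\sqcup\{0\}.$$ Then $$|C|^8|D|^4|\Gamma|^2\ll|A|^8|S_\Gamma(C-C)|\,\mathsf{E}^+(\Gamma)\log^2|A|.$$ If moreover $|\Gamma|\ll p^{3/5-o(1)}$ then $|C|^4|D|^2\ll|A|^4|S_\Gamma(C-C)|^{2/3}\log|A|$.
   Context: $S_\Gamma(Q)$ is the minimal $\Gamma$-invariant set containing $Q$ (equivalently $\Gamma Q$). $\mathsf{E}^+(\Gamma)=|\{(x_1,x_2,x_3,x_4)\in\Gamma^4:x_1+x_2=x_3+x_4\}|$. $X\ll Y$ means $X\le cY$ with an absolute constant $c$. *)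

(* Defs.v *)
From mathcomp Require Import all_boot all_algebra.
From Stdlib Require Import Reals.
Set Implicit Arguments. Unset Strict Implicit. Unset Printing Implicit Defensive.
Import GRing.Theory.
Local Open Scope ring_scope.

Section Defs.
Variable p : nat.
Local Notation F := ('F_p).

Definition mult_subgroup (A : {set F}) : Prop :=
  0 \notin A /\ 1 \in A /\
  (forall x y, x \in A -> y \in A -> x * y \in A) /\
  (forall x, x \in A -> x^-1 \in A).

Definition affine_image (xi s : F) (A : {set F}) : {set F} :=
  [set xi * a + s | a in A].

Definition diffset (C D : {set F}) : {set F} :=
  [set c - d | c in C, d in D].

Definition S_ (G Q : {set F}) : {set F} :=
  [set g * q | g in G, q in Q].

Definition add_energy (G : {set F}) : nat :=
  #|[set x : F * F * F * F |
      [&& x.1.1.1 \in G, x.1.1.2 \in G, x.1.2 \in G, x.2 \in G &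
          x.1.1.1 + x.1.1.2 == x.1.2 + x.2]]|.
End Defs.

(* the zero of F_p, to avoid scope clashes with Stdlib reals in statements *)
Definition zeroF (p : nat) : 'F_p := 0.

(* Main.v *)
(** Write [t = |A|].  Every triple [(c, c', d)] in [C * C * D] with [d] distinct
    from [c] and [c'] gives a ratio [lam = (c - d) / (c' - d)] in [G] such that
    [lam - 1 = (c - c') / (c' - d)] is in the orbit set [S = S_ G (C - C)].
    Dividing by the coordinate of [d] in [A], a fibre of this map has at most
    [t * r lam] elements, where [r lam] counts the solutions in [A * A] of
    [x - zeta = lam * (y - zeta)], [zeta = eta / xi].  By Cauchy-Schwarz,
    [|C|^4 |D|^2 << |L| * t^2 * (sum of r lam ^ 2)], [L] being the set of ratios.

    Stepanov's method bounds by [<< (k t)^(2/3)] the number of [w] for which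
    [(w^t, (1 - w)^t)] lies in a given set of [k] pairs, when [k << t^2] and
    [k t^4 <= p^3].  Now [r lam] is at most the number of [z] such that
    [(z^t, (1 - z)^t)] is a fixed multiple of [(w^t, (1 - w)^t)] for
    [w = 1 / (1 - lam)].  A first use of the bound shows that [<< t^2 / tau^3]
    pairs have at least [tau] such [z]; a second one, applied to these pairs,
    shows that [r lam >= tau] for [<< t^2 / tau^2] values of [lam].  Summing over
    [tau], the sum of [r lam ^ 2] is [<< t^2 log t].

    Since [S] is [G]-invariant, [|G| |L|] counts the pairs in [G * G] with
    difference in [S], so [(|G| |L|)^2 <= |S| E(G)]; this gives the first estimate.
    For the second one, [L] consists, up to [1], of points [w] with [w^|G| = 1] and
    [(1 - w)^|G|] in a set of at most [|S| / |G|] values, so that Stepanov's bound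
    gives [|L| << |S|^(2/3)].  It applies when [|S| / |G| < |G|^(1/2)], and otherwise
    [|L| <= |G|] suffices. *)

Require Import Defs.
From mathcomp Require Import all_boot all_algebra.
From mathcomp Require Import zify ring.
Set Implicit Arguments. Unset Strict Implicit. Unset Printing Implicit Defensive.
Import GRing.Theory.
Local Open Scope ring_scope.

(** * Stepanov's method *)

Section Stepanov.
Variables (F : finFieldType) (p : nat).
Hypothesis charFp : p \in [pchar F].

Lemma natr_neq0_pchar n : (0 < n < p)%N -> n%:R != 0 :> F.
Proof.
move=> /andP[n0 np]; rewrite -(dvdn_pcharf charFp).
by apply/negP => /(dvdn_leq n0); rewrite leqNgt np.
Qed.

Lemma natrB_neq0_pchar m n :
  (m < p)%N -> (n < p)%N -> m != n -> m%:R - n%:R != 0 :> F.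
Proof.
move=> mp np; case: (ltngtP m n) => // h _.
  by rewrite -opprB oppr_eq0 -natrB ?(ltnW h) // natr_neq0_pchar //; lia.
by rewrite -natrB ?(ltnW h) // natr_neq0_pchar //; lia.
Qed.

Lemma dvdp_exp_deriv (q Q : {poly F}) n : q ^+ n.+1 %| Q -> q ^+ n %| Q^`().
Proof.
move=> /dvdpP[H ->]; rewrite derivM dvdp_add //.
  by rewrite exprS mulrA dvdp_mulIr.
by rewrite dvdp_mull // deriv_exp /= -mulr_natr -mulrA mulrCA dvdp_mulIl.
Qed.

Lemma mulX_derivXn n : 'X * ('X^n)^`() = n%:R *: 'X^n :> {poly F}.
Proof.
rewrite derivXn mulrnAr scaler_nat.
by case: n => [|n]; rewrite ?mulr0n // -exprS.
Qed.

(* A polynomial with [N] terms and degree less than [p] vanishes at [1] to order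
   less than [N]: apply ['X * d/d'X - m] to kill the term ['X^m], and induct. *)
Lemma sparse_dvdp_eq0 (s : seq nat) (c : nat -> F) :
    uniq s -> {in s, forall n, (n < p)%N} ->
    ('X - 1) ^+ size s %| \sum_(n <- s) c n *: 'X^n ->
  {in s, forall n, c n = 0}.
Proof.
elim: s c => [|m s IH] c //= /andP[ms us] lts.
rewrite big_cons; set Q := (X in _ %| X) => dQ.
have mp : (m < p)%N by apply: lts; rewrite inE eqxx.
have cs0 : {in s, forall n, c n = 0}.
  have: {in s, forall n, (n%:R - m%:R) * c n = 0}.
    apply: (IH (fun n => (n%:R - m%:R) * c n)) => //.
      by move=> n ns; apply: lts; rewrite inE ns orbT.
    have -> : \sum_(n <- s) ((n%:R - m%:R) * c n) *: 'X^n = 'X * Q^`() - m%:R *: Q.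
      rewrite /Q derivD mulrDr scalerDr opprD addrACA.
      rewrite derivZ -scalerAr mulX_derivXn scalerA scalerA mulrC subrr add0r.
      rewrite raddf_sum /= mulr_sumr scaler_sumr -sumrB; apply: eq_bigr => n _.
      by rewrite derivZ -scalerAr mulX_derivXn !scalerA -scalerBl mulrBl mulrC.
    rewrite dvdp_sub // ?dvdp_mull //; first exact: dvdp_exp_deriv.
    rewrite scaler_nat -mulr_natl dvdp_mull //; apply: dvdp_trans dQ.
    by rewrite exprS dvdp_mulIr.
  move=> h n ns; move/eqP: (h n ns); rewrite mulf_eq0 => /orP[|/eqP//].
  rewrite (negPf (natrB_neq0_pchar _ mp _)) //.
    by apply: lts; rewrite inE ns orbT.
  by apply: contra ms => /eqP <-.
move=> n; rewrite inE => /orP[/eqP->|]; last exact: cs0.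
have EQ : Q = c m *: 'X^m.
  by rewrite /Q big_seq big1 ?addr0 // => i /cs0 ->; rewrite scale0r.
have : root Q 1.
  rewrite root_factor_theorem /= polyC1; apply: dvdp_trans dQ.
  by rewrite exprS dvdp_mulIl.
by rewrite EQ /root hornerZ hornerXn expr1n mulr1 => /eqP.
Qed.

(* The factor ['X * (1 - 'X)] makes this derivation preserve the exponents of
   ['X^i * (1 - 'X)^+j]. *)
Definition xdiff (Q : {poly F}) := 'X * (1 - 'X) * Q^`().

(** Each application of [xdiff] lowers the multiplicity of [w] by exactly one: the new cofactor
    takes at [w] the value [w * (1 - w) * m.+1 * H.[w]], nonzero because the multiplicity is below
    [p]. *)
Lemma horner_iter_xdiff_neq0 (w : F) m (H : {poly F}) :
    w != 0 -> w != 1 -> (m < p)%N -> H.[w] != 0 ->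
  (iter m xdiff (H * ('X - w%:P) ^+ m)).[w] != 0.
Proof.
move=> w0 w1; elim: m H => [|m IH] H mp Hw; first by rewrite /= mulr1.
rewrite iterSr.
have -> : xdiff (H * ('X - w%:P) ^+ m.+1) =
   ('X * (1 - 'X) * (H^`() * ('X - w%:P) + m.+1%:R *: H)) * ('X - w%:P) ^+ m.
  rewrite /xdiff derivM deriv_exp derivXsubC mul1r /= -mulr_natl exprS scaler_nat -mulr_natl.
  ring.
apply: IH; first exact: ltnW.
rewrite !hornerE subrr mulr0 add0r !mulf_neq0 //.
  by rewrite subr_eq0 eq_sym.
exact: natr_neq0_pchar.
Qed.

(** If [w] had multiplicity [m < D], the [m]-th iterate would not vanish at [w]; [D <= p] keeps [m]
    below the characteristic. *)
Lemma dvdp_xdiff (Q : {poly F}) (w : F) D :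
    w != 0 -> w != 1 -> (D <= p)%N ->
    (forall j, (j < D)%N -> (iter j xdiff Q).[w] = 0) ->
  ('X - w%:P) ^+ D %| Q.
Proof.
move=> w0 w1 Dp h; have [->|Q0] := eqVneq Q 0; first exact: dvdp0.
have [m [q]] := multiplicity_XsubC Q w; rewrite Q0 /= => qw EQ.
have [mD|Dm] := ltnP m D.
  have := h m mD; rewrite EQ => /eqP.
  by rewrite (negPf (horner_iter_xdiff_neq0 w0 w1 _ _)) // (leq_trans mD).
by rewrite EQ dvdp_mull // dvdp_exp2l.
Qed.

Lemma size_multiple_roots (s : seq F) (Q : {poly F}) D :
    uniq s -> Q != 0 -> {in s, forall w, ('X - w%:P) ^+ D %| Q} ->
  (size s * D < size Q)%N.
Proof.
elim: s Q => [|w s IH] Q /=; first by rewrite mul0n size_poly_gt0.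
move=> /andP[ws us] Q0 h.
have /dvdpP[R ER] : ('X - w%:P) ^+ D %| Q by apply: h; rewrite inE eqxx.
have R0 : R != 0 by apply: contraNneq Q0 => R0; rewrite ER R0 mul0r.
have lt : (size s * D < size R)%N.
  apply: IH => // x xs.
  have : ('X - x%:P) ^+ D %| Q by apply: h; rewrite inE xs orbT.
  rewrite ER Gauss_dvdpl // coprimep_expl // coprimep_expr //.
  by rewrite coprimep_XsubC2 // subr_eq0; apply: contraNneq ws => ->.
rewrite ER size_Mmonic // ?size_exp_XsubC; last by rewrite monic_exp ?monicXsubC.
by rewrite mulSn addnS /= addnC ltn_add2r.
Qed.

Lemma size_1subX : size (1 - 'X : {poly F}) = 2%N.
Proof. by rewrite -opprB size_polyN -polyC1 size_XsubC. Qed.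

(** * The auxiliary polynomial *)

Section Auxiliary.
Variables (t a b D : nat) (U : {set F * F}).

(** Conjugate of [xdiff] by ['X^(t * j) * (1 - 'X) ^+ (t * l)]. The large exponents enter only as
    scalars, so each application raises the size by at most one. *)
Definition xdiff_twist (j l : nat) (Q : {poly F}) : {poly F} :=
  xdiff Q + (t * j)%:R *: ((1 - 'X) * Q) - (t * l)%:R *: ('X * Q).

Lemma xdiff_monomial j l Q :
  xdiff (Q * ('X^(t * j) * (1 - 'X) ^+ (t * l))) =
  xdiff_twist j l Q * ('X^(t * j) * (1 - 'X) ^+ (t * l)).
Proof.
have X1 n : 'X * ('X^n)^`() = n%:R * 'X^n :> {poly F}.
  by rewrite mulX_derivXn scaler_nat mulr_natl.
have X2 n : (1 - 'X) * ((1 - 'X) ^+ n)^`() = - n%:R * (1 - 'X) ^+ n :> {poly F}.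
  rewrite deriv_exp derivB derivX -[1]/(1%:P) derivC.
  case: n => [|n]; first by rewrite mulr0n mulr0 oppr0 mul0r.
  by rewrite /= exprS -mulr_natl; ring.
rewrite /xdiff_twist /xdiff !derivM.
set Y := 'X^_ in X1 *; set Z := (1 - 'X)^+_.
have := X1 (t * j)%N; have := X2 (t * l)%N; rewrite -/Z -/Y => eZ eY.
rewrite !scaler_nat -!(mulr_natl (_ * _)).
transitivity ('X * (1 - 'X) * Q^`() * (Y * Z) + Q * (1 - 'X) * Z * ('X * Y^`())
              + Q * 'X * Y * ((1 - 'X) * Z^`())).
  by ring.
by rewrite eY eZ; ring.
Qed.

Lemma size_xdiff_twist j l n (Q : {poly F}) :
  (size Q <= n)%N -> (size (xdiff_twist j l Q) <= n.+1)%N.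
Proof.
have [->|Q0] := eqVneq Q 0.
  by rewrite /xdiff_twist /xdiff deriv0 !mulr0 !scaler0 subr0 addr0 size_poly0.
move=> sQ; have sX : size ('X : {poly F}) = 2%N by rewrite size_polyX.
have n0 : (0 < n)%N by apply: leq_trans sQ; rewrite size_poly_gt0.
have hd : (size Q^`() <= n.-1)%N.
  by have := lt_size_deriv Q0; lia.
rewrite /xdiff_twist /xdiff.
apply: (leq_trans (size_polyD _ _)); rewrite geq_max size_polyN; apply/andP; split.
  apply: (leq_trans (size_polyD _ _)); rewrite geq_max; apply/andP; split.
    apply: (leq_trans (size_polyMleq _ _)).
    have s3 : (size ('X * (1 - 'X) : {poly F})%R <= 3)%N.
      by apply: (leq_trans (size_polyMleq _ _)); rewrite sX size_1subX.
    by rewrite -subn1 leq_subLR; apply: (leq_trans (leq_add s3 hd)); lia.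
  apply: (leq_trans (size_scale_leq _ _)); apply: (leq_trans (size_polyMleq _ _)).
  by rewrite size_1subX; lia.
apply: (leq_trans (size_scale_leq _ _)); apply: (leq_trans (size_polyMleq _ _)).
by rewrite sX add2n /= ltnS.
Qed.

Lemma size_iter_xdiff_twist j l n d (Q : {poly F}) :
  (size Q <= n)%N -> (size (iter d (xdiff_twist j l) Q) <= n + d)%N.
Proof.
by move=> sQ; elim: d => [|d IH]; rewrite ?addn0 // addnS; apply: size_xdiff_twist.
Qed.

Lemma iter_xdiff_twistB j l d P Q :
  iter d (xdiff_twist j l) (P - Q) =
  iter d (xdiff_twist j l) P - iter d (xdiff_twist j l) Q.
Proof.
elim: d => //= d ->; rewrite /xdiff_twist /xdiff derivB.
by rewrite !mulrBr !scalerBr; ring.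
Qed.

Implicit Type f : {ffun 'I_a * 'I_b * 'I_b -> F}.

Definition aux_block f (j l : 'I_b) : {poly F} := \sum_i f (i, j, l) *: 'X^i.

Definition aux_poly f : {poly F} :=
  \sum_(j < b) \sum_(l < b) aux_block f j l * ('X^(t * j) * (1 - 'X) ^+ (t * l)).

(** For [u = (w ^+ t, (1 - w) ^+ t)] this agrees at [w] with the [d]-th iterate of [xdiff] on
    [aux_poly f], but its size is at most [a + d]. A few linear conditions on [f] thus serve all [w]
    over the same [u]. *)
Definition aux_local f (u : F * F) d : {poly F} :=
  \sum_(j < b) \sum_(l < b) (u.1 ^+ j * u.2 ^+ l) *:
    iter d (xdiff_twist j l) (aux_block f j l).

Lemma size_aux_block f j l : (size (aux_block f j l) <= a)%N.
Proof.
apply: (leq_trans (size_sum _ _ _)); apply/bigmax_leqP => i _.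
by apply: (leq_trans (size_scale_leq _ _)); rewrite size_polyXn.
Qed.

Lemma iter_xdiff_aux f d :
  iter d xdiff (aux_poly f) =
  \sum_(j < b) \sum_(l < b) iter d (xdiff_twist j l) (aux_block f j l)
                 * ('X^(t * j) * (1 - 'X) ^+ (t * l)).
Proof.
elim: d => //= d ->; rewrite {1}/xdiff raddf_sum /= /= mulr_sumr.
apply: eq_bigr => j _; rewrite raddf_sum /= mulr_sumr; apply: eq_bigr => l _.
exact: xdiff_monomial.
Qed.

Lemma horner_iter_xdiff_aux f d w :
  (iter d xdiff (aux_poly f)).[w] =
  (aux_local f (w ^+ t, (1 - w) ^+ t) d).[w].
Proof.
rewrite iter_xdiff_aux !horner_sum; apply: eq_bigr => j _.
rewrite !horner_sum; apply: eq_bigr => l _.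
by rewrite hornerZ !hornerM hornerXn horner_exp hornerD hornerN hornerX hornerC !exprM mulrC.
Qed.

Lemma size_aux_poly f : (0 < a)%N -> (0 < b)%N -> (size (aux_poly f) <= a + 2 * (t * b))%N.
Proof.
move=> a0 b0.
apply: (leq_trans (size_sum _ _ _)); apply/bigmax_leqP => j _.
apply: (leq_trans (size_sum _ _ _)); apply/bigmax_leqP => l _.
have sa := size_aux_block f j l.
apply: (leq_trans (size_polyMleq _ _)).
have s1 := size_polyMleq ('X^(t * j) : {poly F}) ((1 - 'X) ^+ (t * l)).
have s2 : (size ((1 - 'X : {poly F}) ^+ (t * l)%N)%R <= (t * l).+1)%N.
  apply: (leq_trans (size_poly_exp_leq _ _)).
  by rewrite size_1subX mul1n.
move: s1; rewrite size_polyXn => s1.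
have : (t * j <= t * b)%N by rewrite leq_mul2l ltnW ?orbT.
have : (t * l <= t * b)%N by rewrite leq_mul2l ltnW ?orbT.
move: sa s1 s2; move: (size (aux_block f j l)).
move: (size ('X^(t * j) * (1 - 'X) ^+ (t * l) : {poly F})%R).
move: (size ((1 - 'X : {poly F}) ^+ (t * l)%N)%R).
move: (t * l)%N (t * j)%N (t * b)%N => *; lia.
Qed.

(* If the auxiliary polynomial vanishes, let [l] be the least exponent of
   [(1 - 'X)^+t] whose coefficient is nonzero: this coefficient is divisible by
   [(1 - 'X)^+t] but has at most [a * b <= t] terms. *)
Lemma aux_poly_neq0 f :
  (a * b <= t)%N -> (t * b <= p)%N -> f != 0 -> aux_poly f != 0.
Proof.
move=> abt tbp; apply: contraNneq => Q0.
pose g l : {poly F} := \sum_j aux_block f j l * 'X^(t * j).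
have Eg : \sum_l g l * ((1 - 'X) ^+ t) ^+ l = 0.
  rewrite -[RHS]Q0 /aux_poly [RHS]exchange_big /=; apply: eq_bigr => l _.
  by rewrite /g mulr_suml; apply: eq_bigr => j _; rewrite -exprM mulrA.
have key (l : 'I_b) : (forall l' : 'I_b, (l' < l)%N -> g l' = 0) ->
    forall i j, f (i, j, l) = 0.
  move=> lt0.
  have dv : ('X - 1) ^+ t %| g l.
    have nz : ((1 - 'X : {poly F}) ^+ t) ^+ l != 0.
      by rewrite !expf_neq0 // -size_poly_gt0 size_1subX.
    have d1 : (1 - 'X : {poly F}) ^+ t * ((1 - 'X) ^+ t) ^+ l %| g l * ((1 - 'X) ^+ t) ^+ l.
      move: Eg; rewrite (bigD1 l) //= => /eqP; rewrite addr_eq0 => /eqP ->.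
      rewrite dvdpNr; apply: (big_ind (fun q => _ %| q)) => [|x y|l' l'l].
      - exact: dvdp0.
      - exact: dvdp_add.
      - have [h|h] := ltnP l' l; first by rewrite lt0 ?mul0r ?dvdp0.
        rewrite -exprS dvdp_mull // dvdp_exp2l // ltn_neqAle h andbT.
        by apply: contraNneq l'l => e; apply/eqP/val_inj.
    move: d1; rewrite dvdp_mul2r //; apply: dvdp_trans.
    by apply: dvdp_exp2r; rewrite -opprB dvdpNl.
  (* Exponents of [g l]: distinct because [i < a <= t], below [t * b <= p], and [a * b <= t] in
     number, as [sparse_dvdp_eq0] requires. *)
  pose e (z : 'I_a * 'I_b) := (t * z.2 + z.1)%N.
  have at_ (z : 'I_a * 'I_b) : (z.1 < t)%N.
    case: z => i j /=; apply: leq_trans abt; apply: (leq_trans (ltn_ord i)).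
    by rewrite leq_pmulr //; apply: leq_ltn_trans (ltn_ord j).
  have einj : injective e.
    move=> z z' E; have := at_ z; have := at_ z'; case: z z' E => i j [i' j'].
    rewrite /e /= => E h' h.
    have Ei : i = i'.
      apply/val_inj => /=; have := congr1 (fun n => n %% t)%N E.
      by rewrite !(mulnC t) !modnMDl !modn_small.
    have Ej : j = j'.
      apply/val_inj => /=; have := congr1 (fun n => n %/ t)%N E.
      have t0 : (0 < t)%N by lia.
      by rewrite !(mulnC t) !divnMDl // !divn_small // !addn0.
    by rewrite Ei Ej.
  pose s := [seq e z | z : 'I_a * 'I_b].
  pose c n := if [pick z | e z == n] is Some z then f (z, l) else 0.
  have ce z : c (e z) = f (z, l).
    by rewrite /c; case: pickP => [z' /eqP/einj->|/(_ z)]; rewrite ?eqxx.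
  have Es : g l = \sum_(n <- s) c n *: 'X^n.
    rewrite big_map big_enum /= /g.
    rewrite (eq_bigr (fun j => \sum_i f (i, j, l) *: 'X^(e (i, j)))); last first.
      move=> j _; rewrite mulr_suml; apply: eq_bigr => i _.
      by rewrite -scalerAl -exprD addnC.
    rewrite exchange_big pair_big /=; apply: eq_bigr => -[i j] _.
    by rewrite ce.
  have szs : size s = (a * b)%N.
    by rewrite size_map -cardE card_prod !card_ord.
  have H : {in s, forall n, c n = 0}.
    apply: sparse_dvdp_eq0.
    - by rewrite map_inj_uniq ?enum_uniq.
    - move=> n /mapP[z _ ->]; apply: leq_trans tbp; rewrite /e.
      apply: (@leq_trans (t * z.2.+1)); first by rewrite mulnSr ltn_add2l.
      by rewrite leq_mul2l ltn_ord orbT.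
    - by rewrite szs -Es; apply: dvdp_trans dv; rewrite dvdp_exp2l.
  move=> i j; rewrite -(ce (i, j)) H //.
  by apply/mapP; exists (i, j); rewrite ?mem_enum.
have fl n : forall l : 'I_b, (l < n)%N -> forall i j, f (i, j, l) = 0.
  elim: n => // n IH l ln; apply: key => l' l'l; rewrite /g big1 // => j _.
  rewrite /aux_block big1 ?mul0r // => i _; rewrite IH ?scale0r //; lia.
by apply/eqP/ffunP => -[[i j] l]; rewrite (fl b) ?ffunE.
Qed.

(* Pigeonhole: there are more choices of [f] than values of the coefficients of
   all the [aux_local f u d]. *)
Lemma aux_exists :
  (#|U| * D * (a + D) < a * b ^ 2)%N ->
  exists2 f, f != 0 & forall u d, u \in U -> (d < D)%N -> aux_local f u d = 0.
Proof.
move=> lt.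
pose V := {ffun {u | u \in U} * 'I_D * 'I_(a + D) -> F}.
pose phi f : V := [ffun z : {u | u \in U} * 'I_D * 'I_(a + D) =>
  (aux_local f (val z.1.1) z.1.2)`_z.2].
have /injectivePn[f [g fg Efg]] : ~~ injectiveb phi.
  apply/negP => /injectiveP/leq_card; rewrite !card_ffun !card_prod !card_ord card_sig.
  have F1 : (1 < #|F|)%N.
    by apply/card_gt1P; exists 0, 1; rewrite !inE eq_sym oner_neq0.
  rewrite leq_exp2l // => le; move: lt.
  by rewrite ltnNge => /negP[]; rewrite -mulnn mulnA.
exists (f - g); first by rewrite subr_eq0.
(* By additivity, the difference of two colliding choices satisfies all the linear conditions. *)
have E u d : aux_local (f - g) u d = aux_local f u d - aux_local g u d.
  rewrite /aux_local -sumrB; apply: eq_bigr => j _; rewrite -sumrB; apply: eq_bigr => l _.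
  rewrite -scalerBr -iter_xdiff_twistB; congr (_ *: iter _ _ _).
  by rewrite /aux_block -sumrB; apply: eq_bigr => i _; rewrite !ffunE scalerBl.
move=> u d uU dD; rewrite E; apply/eqP; rewrite subr_eq0; apply/eqP/polyP => n.
have sz h : (size (aux_local h u d) <= a + D)%N.
  apply: (leq_trans (size_sum _ _ _)); apply/bigmax_leqP => j _.
  apply: (leq_trans (size_sum _ _ _)); apply/bigmax_leqP => l _.
  apply: (leq_trans (size_scale_leq _ _)).
  apply: (leq_trans (size_iter_xdiff_twist _ _ _ (size_aux_block _ _ _))).
  by rewrite leq_add2l ltnW.
have [naD|aDn] := ltnP n (a + D); last by rewrite !nth_default // (leq_trans (sz _)).
move/ffunP: Efg => /(_ (exist _ u uU, Ordinal dD, Ordinal naD)).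
by rewrite !ffunE.
Qed.

Definition pts (V : {set F * F}) : {set F} :=
  [set w | [&& w != 0, w != 1 & (w ^+ t, (1 - w) ^+ t) \in V]].

(** The auxiliary polynomial is nonzero and has a zero of order [D] at every point of [pts U];
    compare with its size. Here [D <= a <= t <= t * b <= p]. *)
Lemma stepanov :
    (0 < D)%N -> (D <= a)%N -> (0 < b)%N -> (a * b <= t)%N -> (t * b <= p)%N ->
    (#|U| * D * (a + D) < a * b ^ 2)%N ->
  (#|pts U| * D <= a + 2 * (t * b))%N.
Proof.
move=> D0 Da b0 abt tbp /aux_exists[f f0 hf].
have Q0 := aux_poly_neq0 abt tbp f0.
have a0 : (0 < a)%N by apply: leq_trans Da.
apply: leq_trans (size_aux_poly f a0 b0).
rewrite cardE; apply/ltnW/size_multiple_roots => //; first exact: enum_uniq.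
move=> w; rewrite mem_enum inE => /and3P[w0 w1 wU].
apply: dvdp_xdiff => //; first by nia.
by move=> j jD; rewrite horner_iter_xdiff_aux hf // horner0.
Qed.
End Auxiliary.
End Stepanov.

(** * The multiplicative energy of a shifted subgroup *)

Lemma cube_root_nat n : exists b, (b ^ 3 <= n < b.+1 ^ 3)%N.
Proof.
elim: n => [|n [b /andP[h1 h2]]]; first by exists 0%N.
have [h|h] := ltnP n.+1 (b.+1 ^ 3); first by exists b; rewrite h (leq_trans h1).
exists b.+1; rewrite h /= (leq_ltn_trans h2) // ltn_exp2r //.
Qed.

Section LevelSets.
Variables (F : finFieldType) (p : nat).
Hypothesis charFp : p \in [pchar F].
Variable t : nat.
Implicit Types U : {set F * F}.

(* Stepanov's bound with [b ~ (k t)^(1/3)], [a ~ t / b], [D ~ b^2 / (2 k)]. *)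
Lemma card_pts U :
    (512 * #|U| < t ^ 2)%N -> (#|U| * t ^ 4 <= p ^ 3)%N ->
  (#|pts t U| ^ 3 <= 96 ^ 3 * (#|U| * t) ^ 2)%N.
Proof.
move: (@stepanov F p charFp t) => step h1 h2.
have [k0|k0] := posnP #|U|.
  have -> : pts t U = set0.
    apply/setP => w; rewrite !inE.
    by move/eqP: k0; rewrite cards_eq0 => /eqP ->; rewrite inE !andbF.
  by rewrite cards0.
have t0 : (0 < t)%N by case: (t) h1.
have [b /andP[b1 b2]] := cube_root_nat (#|U| * t).
have {}step := step _ b _ U; move: (#|pts t U|) step => W.
move: (#|U|) h1 h2 k0 b1 b2 => k h1 h2 k0 b1 b2 step.
have b0 : (0 < b)%N by case: (b) b2 => //; nia.
have b3 : (k * t <= 8 * b ^ 3)%N.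
  apply: leq_trans (ltnW b2) _; rewrite (_ : 8 = 2 ^ 3)%N // -expnMn leq_exp2r //; lia.
(* This is the origin of [512]: if [b ^ 2 <= 2 * k], then
   [(k * t) ^ 2 <= 64 * b ^ 6 <= 512 * k ^ 3]. *)
have kb : (2 * k < b ^ 2)%N.
  rewrite ltnNge; apply/negP => bk.
  have e1 : ((b ^ 2) ^ 3 <= (2 * k) ^ 3)%N by rewrite leq_exp2r.
  have e2 : ((k * t) ^ 2 <= (8 * b ^ 3) ^ 2)%N by rewrite leq_exp2r.
  have e3 : ((k * t) ^ 2 <= 512 * k * k ^ 2)%N.
    apply: leq_trans e2 _; rewrite (_ : (8 * b ^ 3) ^ 2 = 64 * (b ^ 2) ^ 3)%N; last by ring.
    apply: (@leq_trans (64 * (2 * k) ^ 3)); first by rewrite leq_mul2l e1.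
    by rewrite leq_eqVlt; apply/orP; left; apply/eqP; ring.
  move: e3; rewrite expnMn mulnC leq_mul2r leqNgt h1 orbF.
  by rewrite expn_eq0 /= -leqn0 leqNgt k0.
have tbp : (t * b <= p)%N.
  rewrite -(leq_exp2r _ _ (isT : (0 < 3)%N)); apply: leq_trans h2.
  rewrite expnMn (_ : k * t ^ 4 = t ^ 3 * (k * t))%N; last by ring.
  by rewrite leq_mul2l b1 orbT.
(* The predecessor makes [2 * k * D < b ^ 2] strict; with [D <= a] this gives the strict inequality
   of the pigeonhole argument. *)
pose D := ((b ^ 2).-1 %/ (2 * k))%N; pose a := (t %/ b)%N.
have D1 : (2 * k * D < b ^ 2)%N.
  have := leq_trunc_div (b ^ 2).-1 (2 * k); rewrite -/D; move: kb.
  by case: (b ^ 2)%N => //= n _; rewrite ltnS mulnC.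
have D2 : (b ^ 2 <= 2 * k * D.+1)%N.
  have : ((b ^ 2).-1 < 2 * k * D.+1)%N by rewrite mulnC ltn_ceil // muln_gt0.
  by move: kb; case: (b ^ 2)%N.
have D0 : (0 < D)%N by rewrite divn_gt0 ?muln_gt0 //; move: kb; case: (b ^ 2)%N.
have Da : (D <= a)%N.
  rewrite leq_divRL //; rewrite -(leq_pmul2l k0).
  apply: leq_trans b1; rewrite expnSr mulnA leq_mul //; nia.
have abt : (a * b <= t)%N by apply: leq_trunc_div.
have kDa : (k * D * (a + D) < a * b ^ 2)%N.
  have a0 : (0 < a)%N by apply: leq_trans Da.
  apply: (@leq_ltn_trans (a * (2 * k * D))); last by rewrite ltn_pmul2l.
  rewrite (_ : a * (2 * k * D) = k * D * (a + a))%N; last by ring.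
  by rewrite leq_mul2l leq_add2l Da orbT.
have := step a D D0 Da b0 abt tbp kDa => WD.
have at_ : (a <= t * b)%N by apply: leq_trans (leq_div _ _) _; rewrite leq_pmulr.
(* Multiply [W * D <= 3 * (t * b)] by [4 * k], use [b ^ 2 <= 2 * k * D.+1 <= 4 * k * D], and cancel
   [b]. With the factor [8] of [b3] this leads to [96 = 12 * 8]. *)
have e1 : (W * b <= 12 * (k * t))%N.
  rewrite -(leq_pmul2r b0) -mulnA.
  apply: (@leq_trans (W * (4 * k * D))).
    by rewrite leq_mul2l; apply/orP; right; move: D2; rewrite -mulnn; nia.
  apply: (@leq_trans (4 * k * (3 * (t * b)))).
    by rewrite mulnCA leq_mul2l; apply/orP; right; lia.
  by rewrite leq_eqVlt; apply/orP; left; apply/eqP; ring.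
have e2 : (W <= 96 * b ^ 2)%N.
  rewrite -(leq_pmul2r b0); apply: leq_trans e1 _.
  apply: (@leq_trans (12 * (8 * b ^ 3))); first by rewrite leq_mul2l b3.
  by rewrite leq_eqVlt; apply/orP; left; apply/eqP; ring.
apply: (@leq_trans ((96 * b ^ 2) ^ 3)); first by rewrite leq_exp2r.
rewrite expnMn leq_mul2l; apply/orP; right.
by rewrite -expnM (_ : 2 * 3 = 3 * 2)%N // expnM leq_exp2r.
Qed.

Definition coset_pts (u : F * F) : {set F} := pts t [set u].

Lemma pts_cover U : #|pts t U| = (\sum_(u in U) #|coset_pts u|)%N.
Proof.
rewrite -sum1_card (partition_big (fun w : F => (w ^+ t, (1 - w) ^+ t)) (mem U)) /=.
  2: by move=> w; rewrite inE => /and3P[].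
apply: eq_bigr => u uU; rewrite -sum1_card; apply: eq_bigl => w.
rewrite !inE; case: (_ =P u) => [->|_]; last by rewrite !andbF.
by rewrite uU !andbT.
Qed.

Lemma card_root_set (Q : {poly F}) (B : {set F}) :
  Q != 0 -> {in B, forall x, root Q x} -> (#|B| < size Q)%N.
Proof.
move=> Q0 h; rewrite cardE; apply: max_poly_roots => //.
  by apply/allP => x; rewrite mem_enum => /h.
exact: enum_uniq.
Qed.

Lemma card_pow_fibre (B : {set F}) (u : F) :
  (0 < t)%N -> {in B, forall x, x ^+ t = u} -> (#|B| <= t)%N.
Proof.
move=> t0 h; have s := size_XnsubC u t0.
rewrite -ltnS -s; apply: card_root_set; first by rewrite -size_poly_gt0 s.
by move=> x /h xu; rewrite /root !hornerE xu subrr.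
Qed.

Hypotheses (t0 : (0 < t)%N) (tp : (t ^ 2 <= p)%N).

Lemma card_coset_pts u : (#|coset_pts u| <= t)%N.
Proof.
by apply: (@card_pow_fibre _ u.1) => // w; rewrite !inE => /and3P[_ _ /eqP <-].
Qed.

Definition popular tau : {set F * F} := [set u | (tau <= #|coset_pts u|)%N].

(** The fibres over [U] are disjoint, so [#|U| * tau <= #|pts t U|]; cube, apply [card_pts] and
    cancel [#|U| ^ 2]. *)
Lemma card_popular_sub U tau :
    U \subset popular tau -> (0 < tau)%N -> (512 * #|U| < t ^ 2)%N ->
  (#|U| * tau ^ 3 <= 96 ^ 3 * t ^ 2)%N.
Proof.
move=> sU tau0 h.
have [->//|k0] := posnP #|U|.
have h2 : (#|U| * t ^ 4 <= p ^ 3)%N.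
  apply: (@leq_trans ((t ^ 2) ^ 3)); last by rewrite leq_exp2r.
  rewrite -expnM (_ : 2 * 3 = 2 + 4)%N // expnD leq_mul2r; apply/orP; right; lia.
have := card_pts h h2; rewrite pts_cover => h3.
have h4 : (#|U| * tau <= \sum_(u in U) #|coset_pts u|)%N.
  rewrite -sum_nat_const; apply: leq_sum => u /(subsetP sU).
  by rewrite inE.
have h5 : ((#|U| * tau) ^ 3 <= 96 ^ 3 * (#|U| * t) ^ 2)%N.
  by apply: leq_trans h3; rewrite leq_exp2r.
have k2 : (0 < #|U| ^ 2)%N by rewrite expn_gt0 k0.
rewrite -(leq_pmul2l k2).
by move: h5; rewrite !expnMn (mulnCA (96 ^ 3)%N) expnSr -mulnA.
Qed.

(* If [popular tau] is too large for [card_pts], a subset of about [t^2 / 512]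
   elements contradicts [card_popular_sub], because [1000^3 > 1024 * 96^3]. *)
Lemma card_popular tau :
  (1000 <= tau)%N -> (#|popular tau| * tau ^ 3 <= 96 ^ 3 * t ^ 2)%N.
Proof.
move=> tau1; have tau0 : (0 < tau)%N by lia.
have [small|big] := ltnP (512 * #|popular tau|) (t ^ 2).
  exact: card_popular_sub.
have [ttau|taut] := ltnP t tau.
  suff -> : popular tau = set0 by rewrite cards0.
  apply/setP => u; rewrite !inE; apply/negbTE; rewrite -ltnNge.
  exact: leq_ltn_trans (card_coset_pts u) ttau.
pose k := ((t ^ 2).-1 %/ 512)%N.
have t2 : (1000 ^ 2 <= t ^ 2)%N by rewrite leq_exp2r // (leq_trans tau1).
have [k1 k2] : (512 * k < t ^ 2 /\ t ^ 2 <= 512 * k.+1)%N.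
  have := leq_trunc_div (t ^ 2).-1 512; have := ltn_ceil (t ^ 2).-1 (isT : (0 < 512)%N).
  rewrite -/k; move: t2; case: (t ^ 2)%N => [//|n] /=; lia.
have kle : (k <= #|popular tau|)%N by lia.
have [U UP cU] : exists2 U : {set F * F}, U \subset popular tau & #|U| = k.
  have : (0 < #|[set B : {set F * F} | B \subset popular tau & #|B| == k]|)%N.
    by rewrite cards_draws bin_gt0.
  by case/card_gt0P => U; rewrite inE => /andP[sU /eqP cU]; exists U.
have := card_popular_sub UP tau0; rewrite cU => /(_ k1) h.
have t3 : (1000 ^ 3 <= tau ^ 3)%N by rewrite leq_exp2r.
exfalso; move: h t3 k1 k2 t2; move: (tau ^ 3)%N (t ^ 2)%N => x y.
clear; nia.
Qed.
End LevelSets.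

(** * Cauchy-Schwarz over fibres *)

Lemma leq_sqr_sum (I : finType) (L : {set I}) (n : I -> nat) :
  ((\sum_(i in L) n i) ^ 2 <= #|L| * \sum_(i in L) n i ^ 2)%N.
Proof.
rewrite -(leq_pmul2l (isT : (0 < 2)%N)) -mulnn big_distrlr /= big_distrr /=.
apply: (@leq_trans (\sum_(i in L) \sum_(j in L) (n i ^ 2 + n j ^ 2))%N).
  by apply: leq_sum => i _; rewrite big_distrr; apply: leq_sum => j _; apply: nat_Cauchy.
under eq_bigr do rewrite big_split /= sum_nat_const.
by rewrite big_split /= sum_nat_const -big_distrr /= addnn -mul2n.
Qed.

Lemma card_fibre_sqr (T T' : finType) (P : {set T}) (f : T -> T') (L : {set T'}) :
    {in P, forall x, f x \in L} ->
  (#|P| ^ 2 <= #|L| * \sum_(l in L) #|[set x in P | f x == l]| ^ 2)%N.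
Proof.
move=> fP; rewrite -sum1_card (partition_big f (mem L)) //.
apply: leq_trans (leq_sqr_sum _ _) _; rewrite leq_mul2l; apply/orP; right.
by apply: leq_sum => l _; rewrite leq_exp2r // -sum1dep_card.
Qed.

Lemma sum_fibre_sqr (T T' : finType) (P : {set T}) (f : T -> T') (L : {set T'}) :
  (\sum_(l in L) #|[set x in P | f x == l]| ^ 2
     <= #|[set xy : T * T | [&& xy.1 \in P, xy.2 \in P & f xy.1 == f xy.2]]|)%N.
Proof.
rewrite -[X in (_ <= X)%N]sum1_card (partition_big (fun xy => f xy.1) predT) //=.
rewrite [X in (_ <= X)%N](bigID (mem L)) /=; apply: leq_trans (leq_addr _ _).
apply: leq_sum => l _; rewrite -mulnn -cardsX -sum1_card leq_eqVlt; apply/orP; left.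
apply/eqP/eq_bigl => -[x y]; rewrite !inE /=.
by case: (x \in P); case: (y \in P); rewrite ?andbF //=;
  case: (f x =P l) => [->|_]; rewrite ?andbF ?andbT // eq_sym.
Qed.

(** Turns a second moment into a sum over level sets, level [i] having weight [2 * i]. *)
Lemma leq_sqr_sum_nat n : (n ^ 2 <= \sum_(1 <= i < n.+1) 2 * i)%N.
Proof.
elim: n => // n IH; rewrite big_nat_recr //=; apply: (@leq_trans (n ^ 2 + 2 * n.+1)).
  by rewrite -!mulnn; lia.
by rewrite leq_add2r.
Qed.

Section ShiftedEnergy.
Variables (F : finFieldType) (p : nat).
Hypothesis charFp : p \in [pchar F].
Variables (A : {set F}) (zeta : F).
Let t := #|A|.
Hypotheses (t0 : (0 < t)%N) (tp : (t ^ 2 <= p)%N).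
Hypotheses (At : {in A, forall x, x ^+ t = 1}) (zeta0 : zeta != 0).

(** Its cardinality is [r lam]. Excluding [zeta] from both coordinates avoids division by zero and
    leaves no solution for [lam = 0]. *)
Definition ratio_set (lam : F) : {set F * F} :=
  [set xy in setX A A | [&& xy.1 != zeta, xy.2 != zeta
     & (xy.1 - zeta) / (xy.2 - zeta) == lam]].

Definition rich tau : {set F} := [set lam | (tau <= #|ratio_set lam|)%N].

Let A_neq0 x : x \in A -> x != 0.
Proof.
by move=> /At; apply: contra_eqN => /eqP ->; rewrite expr0n eqn0Ngt t0 eq_sym oner_neq0.
Qed.

Lemma ratio_setP lam x y : (x, y) \in ratio_set lam ->
  [/\ x \in A, y \in A, x != zeta, y != zeta & x - zeta = lam * (y - zeta)].
Proof.
rewrite !inE /= => /andP[/andP[xA yA] /and3P[xz yz /eqP <-]].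
by split=> //; rewrite divfK // subr_eq0.
Qed.

Lemma card_ratio_set lam : (#|ratio_set lam| <= t)%N.
Proof.
have /card_in_imset <- : {in ratio_set lam &, injective (fun xy => xy.2)}.
  move=> [x y] [x' y'] /ratio_setP[_ _ _ _ e] /ratio_setP[_ _ _ _ e'] /= E.
  by rewrite -E -e in e'; rewrite E (addIr _ e').
by apply/subset_leq_card/subsetP => _ /imsetP[[x y] /ratio_setP[]] _ yA _ _ _ ->.
Qed.

Lemma ratio_set0 : ratio_set 0 = set0.
Proof.
apply/setP => -[x y]; rewrite [RHS]inE; apply/negP => /ratio_setP[_ _ xz _].
by rewrite mul0r => /eqP; rewrite subr_eq0 (negPf xz).
Qed.

Lemma sum_ratio_set : (\sum_lam #|ratio_set lam| <= t ^ 2)%N.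
Proof.
rewrite -mulnn -cardsX -[X in (_ <= X)%N]sum1_card.
rewrite (partition_big (fun xy => (xy.1 - zeta) / (xy.2 - zeta)) predT) //=.
apply: leq_sum => lam _; rewrite -sum1_card big_mkcond [X in (_ <= X)%N]big_mkcond /=.
apply: leq_sum => xy _; rewrite !inE.
case: (xy.1 \in A); case: (xy.2 \in A); case: (_ == lam); rewrite ?andbF //=.
by case: (_ && _).
Qed.

(** Send [(x, y)] to [z = x * w / zeta]. The relation between [x] and [y] gives
    [1 - z = (1 - w) * y / zeta], and [t]-th powers erase [x] and [y]. *)
Lemma card_ratio_set_pts lam (w := (1 - lam)^-1) :
    lam != 0 -> lam != 1 ->
  (#|ratio_set lam| <= #|coset_pts t (w ^+ t / zeta ^+ t, (1 - w) ^+ t / zeta ^+ t)|)%N.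
Proof.
move=> l0 l1; have l1' : 1 - lam != 0 by rewrite subr_eq0 eq_sym.
have w0 : w != 0 by rewrite invr_eq0.
have w1 : 1 - w = - lam * w by rewrite /w; field.
pose g (xy : F * F) := xy.1 * w / zeta.
have /card_in_imset <- : {in ratio_set lam &, injective g}.
  move=> [x y] [x' y'] /ratio_setP[_ _ _ _ e] /ratio_setP[_ _ _ _ e'] /= E.
  have Ex : x = x' by apply: (mulIf w0); apply: (mulIf (invr_neq0 zeta0)).
  by rewrite Ex e' in e; rewrite Ex (addIr _ (mulfI l0 e)).
apply/subset_leq_card/subsetP => _ /imsetP[[x y] /ratio_setP[xA yA _ _ e] ->].
have Ex : x = zeta + lam * (y - zeta) by rewrite -e addrC subrK.
have Eg : 1 - g (x, y) = - lam * w * y / zeta.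
  by rewrite /g /= Ex /w; field; rewrite l1' zeta0.
have g1 : 1 - g (x, y) != 0.
  by rewrite Eg !(mulf_eq0, oppr_eq0, invr_eq0 zeta) !negb_or l0 w0 zeta0 A_neq0.
have g0 : g (x, y) != 0 by rewrite /g /= !(mulf_eq0, invr_eq0 zeta) !negb_or w0 zeta0 A_neq0.
rewrite !inE g0 -subr_eq0 -opprB oppr_eq0 g1 Eg /g /= w1.
by rewrite !exprMn !exprVn !(At xA) !(At yA) mul1r mulr1.
Qed.

Lemma card_rich_large tau :
  (1000 <= tau)%N -> (#|rich tau :\ 1%R| * tau ^ 2 <= 96 ^ 3 * t ^ 2)%N.
Proof.
move=> tau1; have tau0 : (0 < tau)%N by lia.
have popk := card_popular charFp t0 tp tau1.
pose U := [set (u.1 * zeta ^+ t, u.2 * zeta ^+ t) | u in popular F t tau].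
have Uk : (#|U| <= #|popular F t tau|)%N by apply: leq_imset_card.
have Ut : (#|U| * tau ^ 3 <= 96 ^ 3 * t ^ 2)%N.
  by apply: leq_trans popk; rewrite leq_mul2r Uk orbT.
(* The threshold on [tau] enters here: [1000 ^ 3 > 512 * 96 ^ 3]. *)
have h1 : (512 * #|U| < t ^ 2)%N.
  have t3 : (1000 ^ 3 <= tau ^ 3)%N by rewrite leq_exp2r.
  have t2 : (0 < t ^ 2)%N by rewrite expn_gt0 t0.
  move: Ut t3 t2; move: (tau ^ 3)%N (t ^ 2)%N #|U| => x y z; clear; nia.
have h2 : (#|U| * t ^ 4 <= p ^ 3)%N.
  apply: (@leq_trans ((t ^ 2) ^ 3)); last by rewrite leq_exp2r.
  rewrite -expnM (_ : 2 * 3 = 2 + 4)%N // expnD leq_mul2r; apply/orP; right; lia.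
have h3 := card_pts charFp h1 h2.
have le : (#|rich tau :\ 1%R| <= #|pts t U|)%N.
  have /card_imset <- : injective (fun lam : F => (1 - lam)^-1).
    by move=> x y /invr_inj/addrI/oppr_inj.
  apply/subset_leq_card/subsetP => _ /imsetP[lam + ->].
  rewrite !inE => /andP[l1 rl].
  have l0 : lam != 0.
    by apply: contraTneq rl => ->; rewrite ratio_set0 cards0 -ltnNge.
  have l1' : 1 - lam != 0 by rewrite subr_eq0 eq_sym.
  rewrite invr_eq0 l1' /=; apply/andP; split.
    by rewrite invr_eq1 -subr_eq0 addrC addKr oppr_eq0.
  apply/imsetP; exists ((1 - lam)^-1 ^+ t / zeta ^+ t, (1 - (1 - lam)^-1) ^+ t / zeta ^+ t).
    by rewrite inE; apply: leq_trans rl (card_ratio_set_pts l0 l1).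
  by rewrite /= !divfK // expf_neq0.
rewrite -(leq_exp2r _ _ (isT : (0 < 3)%N)).
apply: (@leq_trans (96 ^ 3 * (#|U| * t) ^ 2 * (tau ^ 2) ^ 3)).
  by rewrite expnMn leq_mul2r; apply/orP; right; apply: leq_trans h3; rewrite leq_exp2r.
rewrite (_ : 96 ^ 3 * (#|U| * t) ^ 2 * (tau ^ 2) ^ 3
           = 96 ^ 3 * t ^ 2 * (#|U| * tau ^ 3) ^ 2)%N.
  by rewrite [X in (_ <= X)%N]expnS leq_mul2l; apply/orP; right; rewrite leq_exp2r.
move: (96 ^ 3)%N => K; ring.
Qed.

(** For [tau < 1000] the first moment gives [#|rich tau| * tau <= t ^ 2], and the other factor [tau]
    goes into the constant. For larger [tau], the value [lam = 1] adds at most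
    [tau ^ 2 <= t ^ 2]. *)
Lemma card_rich tau : (#|rich tau| * tau ^ 2 <= (96 ^ 3 + 1000) * t ^ 2)%N.
Proof.
have [tau1|tau1] := leqP 1000 tau; last first.
  rewrite -mulnn mulnA mulnC; apply: leq_mul; first by lia.
  apply: leq_trans sum_ratio_set; rewrite -sum_nat_const.
  rewrite [X in (_ <= X)%N](bigID (mem (rich tau))) /=; apply: leq_trans (leq_addr _ _).
  by apply: leq_sum => l; rewrite inE.
have [->|/set0Pn[lam]] := eqVneq (rich tau) set0; first by rewrite cards0.
rewrite inE => rl; have taut := leq_trans rl (card_ratio_set lam).
rewrite (cardsD1 1) mulnDl addnC mulnDl; apply: leq_add; first exact: card_rich_large.
by apply: leq_mul; [case: (_ \in _)|rewrite leq_exp2r].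
Qed.

Lemma sum_sqr_ratio_set :
  (\sum_lam #|ratio_set lam| ^ 2 <= \sum_(1 <= tau < t.+1) 2 * (tau * #|rich tau|))%N.
Proof.
apply: (@leq_trans (\sum_lam \sum_(1 <= tau < t.+1 | (tau <= #|ratio_set lam|)%N) 2 * tau)).
  apply: leq_sum => lam _; apply: leq_trans (leq_sqr_sum_nat _) _.
  rewrite (@big_cat_nat _ _ _ #|ratio_set lam|.+1 1 t.+1) //=; last first.
    by rewrite ltnS card_ratio_set.
  apply: leq_trans (leq_addr _ _).
  rewrite big_nat_cond [X in (_ <= X)%N]big_nat_cond; apply: eq_leq.
  by apply: eq_bigl => i; rewrite ltnS; case: (0 < i)%N; case: (i <= _)%N.
under eq_bigr do rewrite big_mkcond.
rewrite exchange_big /=; apply: eq_leq; apply: eq_bigr => tau _.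
by rewrite -big_mkcond /= sum_nat_cond_const mulnC -mulnA.
Qed.
End ShiftedEnergy.

(** * Ratios of differences *)

Section Subgroup.
Variables (p : nat) (A : {set 'F_p}).
Hypothesis sgA : mult_subgroup A.

Lemma subgroup_neq0 x : x \in A -> x != 0.
Proof. by case: sgA => A0 _ xA; apply: contraNneq A0 => <-. Qed.

Lemma subgroup1 : 1 \in A.
Proof. by case: sgA => _ []. Qed.

Lemma subgroupM x y : x \in A -> y \in A -> x * y \in A.
Proof. by case: sgA => _ [_ [h _]]; apply: h. Qed.

Lemma subgroupV x : x \in A -> x^-1 \in A.
Proof. by case: sgA => _ [_ [_ h]]; apply: h. Qed.

Lemma subgroup_div x y : x \in A -> y \in A -> x / y \in A.
Proof. by move=> xA yA; rewrite subgroupM ?subgroupV. Qed.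

Lemma subgroup_gt0 : (0 < #|A|)%N.
Proof. by apply/card_gt0P; exists 1; apply: subgroup1. Qed.

(** Multiplication by [x] permutes [A], hence preserves the product of its elements. *)
Lemma subgroup_expr_card : {in A, forall x, x ^+ #|A| = 1}.
Proof.
move=> x xA; have x0 := subgroup_neq0 xA.
have nz : \prod_(a in A) a != 0 by apply/prodf_neq0 => a; apply: subgroup_neq0.
apply: (mulIf nz); rewrite mul1r -prodr_const -big_split /=.
rewrite [RHS](reindex_onto (fun a => x * a) (fun a => x^-1 * a)) /=; last first.
  by move=> a _; rewrite mulVKf.
apply: eq_bigl => a; rewrite mulKf // eqxx andbT.
apply/idP/idP => [/(subgroupM xA)//|xaA].
by rewrite -(mulKf x0 a) mulrC subgroup_div.
Qed.
End Subgroup.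

Definition energy_const : nat := 96 ^ 3 + 1000.

Section Triples.
Variable p : nat.
Hypothesis prime_p : prime p.
Local Notation F := 'F_p.
Variables (A G C D : {set F}) (xi eta s : F).
Hypotheses (sgA : mult_subgroup A) (sgG : mult_subgroup G).
Hypotheses (xi0 : xi != 0) (eta0 : eta != 0).
Hypotheses (CA : C \subset affine_image xi s A) (DA : D \subset affine_image eta s A).
Hypothesis C3 : (3 <= #|C|)%N.
Hypothesis CDG : diffset C D \subset G :|: [set 0].

Let S := S_ G (diffset C C).
Let t := #|A|.
Let zeta := eta / xi.

(** A set containing all ratios of triples; both bounds on its size rest on these two membership
    conditions. *)
Definition ratios : {set F} := [set lam in G | lam - 1 \in S].

Definition triples : {set F * F * F} :=
  [set x in setX (setX C C) D | (x.1.1 != x.2) && (x.1.2 != x.2)].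

Definition triple_ratio (x : F * F * F) := (x.1.1 - x.2) / (x.1.2 - x.2).

Lemma diff_in_subgroup c d : c \in C -> d \in D -> c != d -> c - d \in G.
Proof.
move=> cC dD cd; have /(subsetP CDG) : c - d \in diffset C D.
  by apply/imset2P; exists c d.
by rewrite !inE subr_eq0 (negPf cd) orbF.
Qed.

Lemma mulr_orbit g x : g \in G -> x \in S -> g * x \in S.
Proof.
move=> gG /imset2P[h q hG qQ ->]; rewrite mulrA.
by apply/imset2P; exists (g * h) q => //; apply: subgroupM.
Qed.

Lemma diff_orbit x y : x \in C -> y \in C -> x - y \in S.
Proof.
move=> xC yC; apply/imset2P; exists 1 (x - y); rewrite ?mul1r ?subgroup1 //.
by apply/imset2P; exists x y.
Qed.

Lemma triple_ratioP x : x \in triples -> triple_ratio x \in ratios.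
Proof.
case: x => [[c c'] d]; rewrite !inE /triple_ratio /=.
move=> /andP[/andP[/andP[cC c'C] dD] /andP[cd c'd]].
have c'd0 : c' - d != 0 by rewrite subr_eq0.
rewrite subgroup_div ?diff_in_subgroup //=.
have -> : (c - d) / (c' - d) - 1 = (c' - d)^-1 * (c - c') by field.
by rewrite mulr_orbit ?subgroupV ?diff_in_subgroup ?diff_orbit.
Qed.

(** Each [d] leaves at least [#|C|.-1 ^ 2] pairs, and [#|C| >= 3] gives [#|C|.-1 >= 2/3 * #|C|]. *)
Lemma card_triples : (4 * (#|C| ^ 2 * #|D|) <= 9 * #|triples|)%N.
Proof.
have : (#|D| * #|C|.-1 ^ 2 <= #|triples|)%N.
  rewrite -sum_nat_const -[#|triples|]sum1_card (partition_big (fun x => x.2) (mem D)) /=.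
    2: by case=> [[c c'] d]; rewrite !inE /= => /andP[/andP[]].
  apply: leq_sum => d dD; rewrite sum1dep_card.
  have -> : #|[set x in triples | x.2 == d]| = #|setX (setX (C :\ d) (C :\ d)) [set d]|.
    apply: eq_card => -[[c c'] d']; rewrite !inE /=.
    case: (d' =P d) => [->|]; rewrite ?andbF // dD !andbT.
    by rewrite [in RHS]andbACA [RHS]andbC.
  rewrite !cardsX cards1 muln1 mulnn leq_exp2r //.
  by rewrite (cardsD1 d C); case: (_ \in _) => //=; rewrite leq_pred.
have : (2 * #|C| <= 3 * #|C|.-1)%N by move: C3; case: #|C| => // n; lia.
move=> le /(leq_mul (leqnn 9)); apply: leq_trans.
rewrite mulnA -(expnMn 2 _ 2) mulnCA -(expnMn 3 _ 2) mulnC leq_mul2l.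
by rewrite leq_exp2r // le orbT.
Qed.

Lemma card_triple_ratio lam :
  (#|[set x in triples | triple_ratio x == lam]| <= t * #|ratio_set A zeta lam|)%N.
Proof.
pose h (x : F * F * F) : F * F :=
  (((x.1.1 - s) / xi) / ((x.2 - s) / eta), ((x.1.2 - s) / xi) / ((x.2 - s) / eta)).
pose f (x : F * F * F) : F * (F * F) := ((x.2 - s) / eta, h x).
have Cs c : c \in C -> (c - s) / xi \in A.
  by move/(subsetP CA)/imsetP => [a aA ->]; rewrite addrK mulrC mulKf.
have Ds d : d \in D -> (d - s) / eta \in A.
  by move/(subsetP DA)/imsetP => [a aA ->]; rewrite addrK mulrC mulKf.
have inj : {in [set x in triples | triple_ratio x == lam] &, injective f}.
  move=> [[c c'] d] [[e e'] d'] + _; rewrite !inE /= => /andP[/andP[/andP[_ dD] _] _].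
  move=> E; have nz := invr_neq0 (subgroup_neq0 sgA (Ds _ dD)).
  have /(mulIf (invr_neq0 eta0))/addIr /= Ed := congr1 (fun z => z.1) E.
  have := congr1 (fun z => z.2.1) E; have := congr1 (fun z => z.2.2) E.
  rewrite /f /h /= -Ed => /(mulIf nz)/(mulIf (invr_neq0 xi0))/addIr <-.
  by move=> /(mulIf nz)/(mulIf (invr_neq0 xi0))/addIr <-.
rewrite -(card_in_imset inj) /t -cardsX.
apply/subset_leq_card/subsetP => _ /imsetP[[[c c'] d] + ->].
rewrite !inE /triple_ratio /= => /andP[/andP[/andP[/andP[cC c'C] dD] /andP[cd c'd]] /eqP <-].
have CDs x : x \in C -> (x - s) / xi / ((d - s) / eta) \in A.
  by move=> xC; apply: subgroup_div (Cs _ xC) (Ds _ dD).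
rewrite Ds // !CDs //=.
have nz := subgroup_neq0 sgA (Ds _ dD).
have ds : d - s != 0 by apply: contraNneq nz => ->; rewrite mul0r.
(* Dividing by the coordinate of [d] sends [d] itself to [zeta]. The scaling factor [k] is the same
   for [c] and [c'], so the ratio is preserved. *)
have [k k0 E] : exists2 k, k != 0 &
    forall x, (x - s) / xi / ((d - s) / eta) - zeta = (x - d) * k.
  exists (eta / (xi * (d - s))); first by rewrite mulf_neq0 ?invr_neq0 ?mulf_neq0.
  by move=> x; rewrite /zeta; field; rewrite eta0 xi0 ds.
rewrite -![_ == zeta]subr_eq0 !E !mulf_eq0 (negPf k0) !orbF !subr_eq0 cd c'd /=.
by rewrite -mulf_div divff // mulr1.
Qed.

Lemma triples_ratios :
  (16 * (#|C| ^ 4 * #|D| ^ 2) <=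
     81 * (#|ratios| * (t ^ 2 * \sum_lam #|ratio_set A zeta lam| ^ 2)))%N.
Proof.
have h := card_triples; rewrite -(leq_exp2r _ _ (isT : (0 < 2)%N)) in h.
rewrite (_ : 16 * (#|C| ^ 4 * #|D| ^ 2) = (4 * (#|C| ^ 2 * #|D|)) ^ 2)%N; last by ring.
apply: (leq_trans h); rewrite (expnMn 9 _ 2) leq_mul2l /=.
apply: leq_trans (card_fibre_sqr triple_ratioP) _; rewrite leq_mul2l; apply/orP; right.
rewrite big_distrr /= [X in (_ <= X)%N](bigID (mem ratios)) /=.
apply: leq_trans (leq_addr _ _).
by apply: leq_sum => lam _; rewrite -expnMn leq_exp2r // card_triple_ratio.
Qed.

(** The level sums are packaged as a sequence with [g i << t ^ 2 / i], whose harmonic sum produces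
    the logarithm. *)
Lemma triples_dyadic : (t ^ 2 <= p)%N -> exists2 g : nat -> nat,
    forall i, (g i * i <= 2 * (energy_const * t ^ 2))%N &
    (16 * (#|C| ^ 4 * #|D| ^ 2) <=
       81 * (#|ratios| * (t ^ 2 * \sum_(1 <= i < t.+1) g i)))%N.
Proof.
move=> tp; have z0 : zeta != 0 by rewrite mulf_neq0 ?invr_eq0.
have t0 := subgroup_gt0 sgA.
exists (fun i => 2 * (i * #|rich A zeta i|))%N.
  move=> i; rewrite -mulnA leq_mul2l /=.
  apply: leq_trans (card_rich (pchar_Fp prime_p) t0 tp (subgroup_expr_card sgA) z0 i).
  by rewrite mulnAC -mulnn mulnC.
apply: (leq_trans triples_ratios); rewrite !leq_mul2l /=.
by rewrite (sum_sqr_ratio_set A zeta) !orbT.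
Qed.

(** The map [(g, l) -> g * (l - 1)] lands in [S]. A collision reads [g * l + g' = g' * l' + g], an
    additive quadruple of [G] that determines both pairs. *)
Lemma ratios_energy : ((#|G| * #|ratios|) ^ 2 <= #|S| * add_energy G)%N.
Proof.
pose f (x : F * F) : F := x.1 * (x.2 - 1).
have fS : {in setX G ratios, forall x, f x \in S}.
  by case=> g l; rewrite !inE /= => /andP[gG /andP[_ lS]]; apply: mulr_orbit.
rewrite -cardsX; apply: leq_trans (card_fibre_sqr fS) _; rewrite leq_mul2l; apply/orP; right.
apply: leq_trans (sum_fibre_sqr _ _ _) _.
pose h (xy : (F * F) * (F * F)) : F * F * F * F :=
  (xy.1.1 * xy.1.2, xy.2.1, xy.2.1 * xy.2.2, xy.1.1).
set B := [set xy | _].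
have /card_in_imset <- : {in B &, injective h}.
  move=> [[g l] [g' l']] [[k m] [k' m']]; rewrite !inE /=.
  move=> /and3P[/andP[gG _] /andP[g'G _] _] _ E.
  have /= Eg := congr1 (fun z => z.2) E; have /= Eg' := congr1 (fun z => z.1.1.2) E.
  have := congr1 (fun z => z.1.2) E; have := congr1 (fun z => z.1.1.1) E.
  rewrite /h /= -Eg -Eg' => /(mulfI (subgroup_neq0 sgG gG)) <-.
  by move=> /(mulfI (subgroup_neq0 sgG g'G)) <-.
apply/subset_leq_card/subsetP => _ /imsetP[[[g l] [g' l']] + ->].
rewrite !inE /= => /and3P[/andP[gG /andP[lG _]] /andP[g'G /andP[l'G _]] /eqP].
rewrite /f /= => E; rewrite !subgroupM ?gG ?g'G //=.
by apply/eqP; move: E; rewrite !mulrBr !mulr1 => E; rewrite -[g * l](subrK g) E; ring.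
Qed.

Lemma ratios_le_subgroup : (#|ratios| <= #|G|)%N.
Proof. by apply/subset_leq_card/subsetP => l; rewrite inE => /andP[]. Qed.

Lemma orbit_gt0 : (0 < #|S|)%N.
Proof.
have /card_gt0P[c cC] : (0 < #|C|)%N by apply: leq_trans C3.
by apply/card_gt0P; exists (c - c); apply: diff_orbit.
Qed.

(** Contains [(1 - l) ^+ #|G|] for every [l != 1] in [ratios]; the sign turns [l - 1] into
    [1 - l]. *)
Definition orbit_powers : {set F} := [set (- x) ^+ #|G| | x in S :\ 0].

(** Each fibre of the power map contains a full orbit [G * x], of size [#|G|]. *)
Lemma card_orbit_powers : (#|orbit_powers| * #|G| <= #|S|)%N.
Proof.
apply: (@leq_trans #|S :\ 0|); last exact/subset_leq_card/subsetDl.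
rewrite -sum_nat_const -[#|S :\ 0|]sum1_card.
rewrite [X in (_ <= X)%N](partition_big (fun x => (- x) ^+ #|G|) (mem orbit_powers)) /=.
  2: by move=> x xS; apply: imset_f.
apply: leq_sum => v /imsetP[x /setD1P[x0 xS] ->]; rewrite sum1dep_card.
have inj : injective (fun g => g * x) by apply: mulIf.
rewrite -[X in (X <= _)%N](card_imset (mem G) inj).
apply/subset_leq_card/subsetP => _ /imsetP[g gG ->].
rewrite !inE mulf_neq0 ?(subgroup_neq0 sgG gG) ?mulr_orbit //=.
by rewrite -mulrN exprMn (subgroup_expr_card sgG) ?mul1r.
Qed.

(** Apply [card_pts] with exponent [#|G|] to the pairs [(1, v)]. The predecessor accounts for the
    value [l = 1], absent from [pts]. *)
Lemma card_ratios_orbit :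
    (512 * #|orbit_powers| < #|G| ^ 2)%N ->
    (#|orbit_powers| * #|G| ^ 4 <= p ^ 3)%N ->
  (#|ratios|.-1 ^ 3 <= 96 ^ 3 * #|S| ^ 2)%N.
Proof.
move=> h1 h2; pose U := [set (1 : F, v) | v in orbit_powers].
have Uk : #|U| = #|orbit_powers| by apply: card_imset => x y [].
rewrite -Uk in h1 h2.
have := card_pts (pchar_Fp prime_p) h1 h2; rewrite Uk => h3.
apply: (@leq_trans (96 ^ 3 * (#|orbit_powers| * #|G|) ^ 2)); last first.
  by rewrite leq_mul2l leq_exp2r // card_orbit_powers orbT.
apply: leq_trans h3; rewrite leq_exp2r //.
apply: (@leq_trans #|ratios :\ 1|).
  by rewrite (cardsD1 1 ratios); case: (_ \in _) => //=; rewrite leq_pred.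
apply/subset_leq_card/subsetP => l; rewrite !inE => /andP[l1 /andP[lG lS]].
rewrite l1 (subgroup_neq0 sgG lG) (subgroup_expr_card sgG lG) /=.
apply/imsetP; exists ((1 - l) ^+ #|G|) => //.
by apply/imsetP; exists (l - 1); rewrite ?opprB // !inE lS subr_eq0 l1.
Qed.
End Triples.

(* Real inequalities: logarithms and fractional powers *)
Local Close Scope ring_scope.
From Stdlib Require Import Reals Lra.
(* [Reals] rebinds this notation to [Nat.pow]. *)
Local Notation "m ^ n" := (expn m n) : nat_scope.

Lemma INRX (m n : nat) : INR (m ^ n)%N = (INR m ^ n)%R.
Proof. by elim: n => // n IH; rewrite expnS mult_INR IH. Qed.

Lemma INRM (m n : nat) : INR (m * n)%N = (INR m * INR n)%R.
Proof. exact: mult_INR. Qed.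

Lemma leq_INR (m n : nat) : (m <= n)%N -> (INR m <= INR n)%R.
Proof. by move/leP; apply: le_INR. Qed.

Lemma inv_le_ln_succ (x : R) : (0 < x)%R -> (1 / (x + 1) <= ln (x + 1) - ln x)%R.
Proof.
move=> x0; have y0 : (0 < x / (x + 1))%R by apply: Rdiv_lt_0_compat; lra.
(* The inequality [1 + y <= exp y] at [y = ln (x / (x + 1))]. *)
have := exp_ineq1_le (ln (x / (x + 1))); rewrite exp_ln // => h.
have e : (ln (x / (x + 1)) = ln x - ln (x + 1))%R.
  rewrite /Rdiv ln_mult ?ln_Rinv //; try lra.
  by apply: Rinv_0_lt_compat; lra.
have e' : (x / (x + 1) = 1 - 1 / (x + 1))%R by field; lra.
by rewrite e e' in h; lra.
Qed.

Lemma sum_le_harmonic (g : nat -> nat) (M n : nat) :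
    (forall i, (g i * i <= M)%N) ->
  (INR (\sum_(1 <= i < n.+2) g i) <= INR M * (1 + ln (INR n.+1)))%R.
Proof.
move=> gM; have gMR i : (INR (g i.+1) <= INR M * (1 / INR i.+1))%R.
  have i0 : (0 < INR i.+1)%R by apply: lt_0_INR; lia.
  have := leq_INR (gM i.+1); rewrite mult_INR => h.
  apply: (Rmult_le_reg_r (INR i.+1)) => //; field_simplify; lra.
elim: n => [|n IH]; first by rewrite big_nat1 /= ln_1; have := gMR 0%N; rewrite /=; lra.
rewrite big_nat_recr //= plus_INR; have := gMR n.+1.
have n0 : (0 < INR n.+1)%R by apply: lt_0_INR; lia.
have := inv_le_ln_succ n0; rewrite -S_INR => h1 h2.
have M0 := pos_INR M.
have : (INR M * (1 / INR n.+2) <= INR M * (ln (INR n.+2) - ln (INR n.+1)))%R.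
  exact: Rmult_le_compat_l.
move: IH h2; rewrite -/(INR n.+2) -/(INR n.+1); lra.
Qed.

Lemma one_le_ln (x : R) : (3 <= x)%R -> (1 <= ln x)%R.
Proof.
move=> x3; rewrite -[1%R]ln_exp; case: (Rle_lt_or_eq_dec _ _ x3) => [h|<-].
  apply/Rlt_le/ln_increasing; first exact: exp_pos.
  by have := exp_le_3; lra.
case: (Rle_lt_or_eq_dec _ _ exp_le_3) => [h|->]; last exact: Rle_refl.
by apply/Rlt_le/ln_increasing => //; apply: exp_pos.
Qed.

Lemma cube_le_Rpower (x M s : R) :
    (0 <= x)%R -> (0 <= M)%R -> (0 < s)%R -> (x ^ 3 <= M ^ 3 * s ^ 2)%R ->
  (x <= M * Rpower s (2 / 3))%R.
Proof.
move=> x0 M0 s0 h; set r := Rpower s (2 / 3).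
have r0 : (0 < r)%R by apply: exp_pos.
have r3 : (r ^ 3 = s ^ 2)%R.
  rewrite -!Rpower_pow // /r Rpower_mult; congr Rpower.
  by rewrite /=; lra.
case: (Rle_lt_dec x (M * r)) => // lt; exfalso.
have y0 : (0 <= M * r)%R by apply: Rmult_le_pos; lra.
have : ((M * r) ^ 3 < x ^ 3)%R.
  have : (0 < x * x)%R by nra.
  move: (M * r)%R lt y0 => y lt y0 xx.
  have : (0 < (x - y) * (x * x + x * y + y * y))%R by apply: Rmult_lt_0_compat; nra.
  by rewrite /=; lra.
by rewrite Rpow_mult_distr r3; lra.
Qed.

Lemma leq_of_pow_INR (m n k : nat) :
  (0 < k)%N -> (INR m ^ k <= INR n ^ k)%R -> (m <= n)%N.
Proof. by move=> k0; rewrite -!INRX => /INR_le/leP; rewrite leq_exp2r. Qed.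

Lemma ratios_le_orbit (p : nat) (G C : {set 'F_p}) (c1 : R) :
    prime p -> mult_subgroup G -> (3 <= #|C|)%N -> (0 < c1)%R ->
    (INR #|G| <= c1 * Rpower (INR p) (3 / 5))%R ->
  (INR #|ratios G C| <= (100 + c1 ^ 15) * Rpower (INR #|S_ G (diffset C C)|) (2 / 3))%R.
Proof.
move=> prime_p sgG C3 c0 Gp.
set L := ratios G C; set S := S_ G (diffset C C).
have S0 := orbit_gt0 sgG C3.
have S1 : (1 <= INR #|S|)%R by apply: (leq_INR S0).
have S2 : (1 <= INR #|S| ^ 2)%R by apply: pow_R1_Rle.
have r1 : (1 <= Rpower (INR #|S|) (2 / 3))%R.
  by rewrite -(Rpower_O (INR #|S|)); [apply: Rle_Rpower; lra|lra].
have c15 : (0 < c1 ^ 15)%R by apply: pow_lt.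
have L0 := pos_INR #|L|.
have step M : (0 <= M)%R -> (M <= 100 + c1 ^ 15)%R ->
    (INR #|L| <= M * Rpower (INR #|S|) (2 / 3))%R ->
    (INR #|L| <= (100 + c1 ^ 15) * Rpower (INR #|S|) (2 / 3))%R.
  by move=> M0 M1 h; apply: Rle_trans h _; apply: Rmult_le_compat_r; lra.
have LG := ratios_le_subgroup G C; rewrite -/L in LG.
(* Raising [|G|^5 <= c1^5 p^3] to the ninth power gives [|G|^45 <= c1^45 p^27], which is at most
   [p^30] once [p >= c1^15]. Smaller [p] go into the constant. *)
case: (Rle_lt_dec (INR p) (c1 ^ 15)) => [small|large].
  apply: (step (c1 ^ 15)%R); [lra|lra|].
  have : (INR #|L| <= INR p)%R.
    by apply: leq_INR; apply: leq_trans (max_card _) _; rewrite card_Fp.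
  by nra.
have [G64|G64] := leqP #|G| 64.
  apply: (step 64%R); [lra|lra|].
  have -> : (64 = INR 64)%R by rewrite /=; lra.
  have := leq_INR (leq_trans LG G64); have := pos_INR 64; nra.
have kS := card_orbit_powers C sgG.
set k := #|orbit_powers G C| in kS.
(* If [|G| <= k^2], the trivial bound suffices: [|L|^3 <= |G|^3 <= (k |G|)^2 <= |S|^2]. *)
have [Gk|kG] := leqP #|G| (k ^ 2).
  apply: (step 1%R); [lra|lra|]; apply: cube_le_Rpower; [lra|lra|lra|].
  rewrite -!INRX pow1 Rmult_1_l; apply: leq_INR.
  apply: (@leq_trans (#|G| ^ 3)); first by rewrite leq_exp2r.
  apply: (@leq_trans ((k * #|G|) ^ 2)); last by rewrite leq_exp2r.
  by rewrite expnMn expnS leq_mul2r Gk orbT.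
have G9 : (#|G| ^ 9 <= p ^ 6)%N.
  apply: (@leq_of_pow_INR _ _ 5) => //; rewrite !INRX.
  have p0 : (0 < INR p)%R by lra.
  have G5 : (INR #|G| ^ 5 <= c1 ^ 5 * INR p ^ 3)%R.
    have -> : (c1 ^ 5 * INR p ^ 3 = (c1 * Rpower (INR p) (3 / 5)) ^ 5)%R.
      rewrite Rpow_mult_distr; congr (_ * _)%R.
      rewrite -!Rpower_pow //; last exact: exp_pos.
      by rewrite Rpower_mult; congr Rpower; rewrite /=; lra.
    by apply: pow_incr; split=> //; apply: pos_INR.
  have -> : ((INR #|G| ^ 9) ^ 5 = (INR #|G| ^ 5) ^ 9)%R by ring.
  apply: (Rle_trans _ ((c1 ^ 5 * INR p ^ 3) ^ 9)).
    by apply: pow_incr; split=> //; apply: pow_le; apply: pos_INR.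
  have -> : ((c1 ^ 5 * INR p ^ 3) ^ 9 = (c1 ^ 15) ^ 3 * INR p ^ 27)%R by ring.
  have -> : ((INR p ^ 6) ^ 5 = INR p ^ 3 * INR p ^ 27)%R by ring.
  apply: Rmult_le_compat_r; first by apply: pow_le; lra.
  by apply: pow_incr; lra.
(* As [|G| >= 65], it is enough that [512 k < 65 |G|]: for [k >= 8] use [512 k <= 65 k^2], otherwise
   [512 k < 65^2]. *)
have h1 : (512 * k < #|G| ^ 2)%N.
  have [k8|k8] := leqP 8 k; apply: (@leq_trans (65 * #|G|)).
  - apply: (@leq_ltn_trans (65 * k ^ 2)); last by rewrite ltn_pmul2l.
    by rewrite -mulnn mulnA leq_mul2r; apply/orP; right; lia.
  - by rewrite -mulnn leq_mul2r G64 orbT.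
  - by lia.
  - by rewrite -mulnn leq_mul2r G64 orbT.
have h2 : (k * #|G| ^ 4 <= p ^ 3)%N.
  rewrite -(leq_exp2r _ _ (isT : (0 < 2)%N)) -[((p ^ 3) ^ 2)%N]expnM; apply: leq_trans G9.
  by rewrite expnMn -expnM (expnS _ 8) leq_mul2r (ltnW kG) orbT.
have := leq_INR (card_ratios_orbit prime_p sgG h1 h2).
rewrite (INRM (96 ^ 3)%N) !INRX -/L -/S => h.
(* [96] from Stepanov's bound plus [1] for the ratio [l = 1]. *)
apply: (step 97%R); [lra|lra|].
have h96 : (INR #|L|.-1 <= INR 96 * Rpower (INR #|S|) (2 / 3))%R.
  by apply: cube_le_Rpower h; [apply: pos_INR|apply: pos_INR|lra].
have e96 : INR 96 = 96%R by rewrite /=; lra.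
have : (INR #|L| <= INR #|L|.-1 + 1)%R.
  by rewrite -S_INR; apply: leq_INR; apply: leqSpred.
by rewrite e96 in h96; lra.
Qed.

(** * Assembling the two estimates *)

Section Bounds.
Variable p : nat.
Hypothesis prime_p : prime p.
Local Notation F := 'F_p.
Variables (A G C D : {set F}) (xi eta s : F).
Hypotheses (sgA : mult_subgroup A) (sgG : mult_subgroup G).
Hypothesis Ap : (INR #|A| < sqrt (INR p))%R.
Hypotheses (xi0 : xi != zeroF p) (eta0 : eta != zeroF p).
Hypotheses (CA : C \subset affine_image xi s A) (DA : D \subset affine_image eta s A).
Hypothesis C3 : (3 <= #|C|)%N.
Hypothesis CDG : diffset C D \subset G :|: [set zeroF p].

Let L := ratios G C.

Lemma card_sqr_le : (#|A| ^ 2 <= p)%N.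
Proof.
have p0 := pos_INR p; have A0 := pos_INR #|A|.
apply/leP/INR_le; rewrite INRX -(sqrt_sqrt _ p0) /= Rmult_1_r.
by apply: Rmult_le_compat => //; apply: Rlt_le.
Qed.

Lemma card_A_ge3 : (3 <= #|A|)%N.
Proof.
apply: leq_trans C3 _; apply: leq_trans (subset_leq_card CA) _.
exact: leq_imset_card.
Qed.

(** The constant [21] exceeds [4 * 81 / 16]: [81 / 16] comes from the count of triples, and [4] from
    [2 * (1 + ln t) <= 4 * ln t], valid as [t >= 3]. *)
Lemma triples_bound :
  (INR #|C| ^ 4 * INR #|D| ^ 2 <=
     21 * INR energy_const * (INR #|L| * (INR #|A| ^ 4 * ln (INR #|A|))))%R.
Proof.
have A3 := card_A_ge3; have A0 : (0 < #|A|)%N by lia.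
have [g gM hE] := triples_dyadic prime_p sgA sgG xi0 eta0 CA DA C3 CDG card_sqr_le.
have := @sum_le_harmonic _ _ #|A|.-1 gM; rewrite prednK //.
move: (\sum_(1 <= tau < _) _)%N hE => E hE hT.
have ln1 : (1 <= ln (INR #|A|))%R by apply: one_le_ln; have := leq_INR A3; rewrite /=; lra.
have := leq_INR hE.
rewrite (INRM 16) (INRM (#|C| ^ 4)%N) (INRM 81) (INRM #|L|) (INRM (#|A| ^ 2)%N) !INRX.
move: hT; rewrite (INRM 2) (INRM energy_const) INRX.
have := pos_INR energy_const; have := pos_INR #|A|; have := pos_INR #|L|.
rewrite -/L.
have -> : INR 16 = 16%R by rewrite /=; lra.
have -> : INR 81 = 81%R by rewrite /=; lra.
have -> : INR 2 = 2%R by rewrite /=; lra.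
move: (ln (INR #|A|)) ln1 => q q1.
move: (INR #|L|) (INR #|A|) (INR energy_const) (INR E) (INR #|C| ^ 4 * INR #|D| ^ 2)%R.
move=> l a K e X l0 a0 K0 he hX.
have a2 : (0 <= a ^ 2)%R by apply: pow_le.
have e1 : (e <= 4 * (K * (a ^ 2 * q)))%R.
  have : (0 <= (K * a ^ 2) * (q - 1))%R by repeat apply: Rmult_le_pos => //; lra.
  by lra.
have e2 : (l * (a ^ 2 * e) <= l * (a ^ 2 * (4 * (K * (a ^ 2 * q)))))%R.
  by apply: Rmult_le_compat_l => //; apply: Rmult_le_compat_l.
have e3 : (l * (a ^ 2 * (4 * (K * (a ^ 2 * q)))) = 4 * (K * (l * (a ^ 4 * q))))%R by ring.
have : (0 <= K * (l * (a ^ 4 * q)))%R.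
  have a4 : (0 <= a ^ 4)%R by apply: pow_le.
  by repeat apply: Rmult_le_pos => //; lra.
lra.
Qed.
End Bounds.

Theorem theorem9 :
  (exists c : R, (0 < c)%R /\
    forall (p : nat), prime p ->
    forall (A G C D : {set 'F_p}) (xi eta s : 'F_p),
      mult_subgroup A -> mult_subgroup G ->
      (INR #|A| < sqrt (INR p))%R ->
      (zeroF p \notin C) -> (zeroF p \notin D) ->
      xi != zeroF p -> eta != zeroF p ->
      C \subset affine_image xi s A -> D \subset affine_image eta s A ->
      (3 <= #|C|)%N ->
      diffset C D \subset G :|: [set zeroF p] ->
      (INR #|C| ^ 8 * INR #|D| ^ 4 * INR #|G| ^ 2 <=
         c * INR #|A| ^ 8 * INR #|S_ G (diffset C C)| * INR (add_energy G)
           * ln (INR #|A|) ^ 2)%R)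
  /\
  (exists delta : nat -> R, Un_cv delta 0%R /\
    forall c1 : R, (0 < c1)%R -> exists c2 : R, (0 < c2)%R /\
    forall (p : nat), prime p ->
    forall (A G C D : {set 'F_p}) (xi eta s : 'F_p),
      mult_subgroup A -> mult_subgroup G ->
      (INR #|A| < sqrt (INR p))%R ->
      (zeroF p \notin C) -> (zeroF p \notin D) ->
      xi != zeroF p -> eta != zeroF p ->
      C \subset affine_image xi s A -> D \subset affine_image eta s A ->
      (3 <= #|C|)%N ->
      diffset C D \subset G :|: [set zeroF p] ->
      (INR #|G| <= c1 * Rpower (INR p) (3 / 5 - delta p))%R ->
      (INR #|C| ^ 4 * INR #|D| ^ 2 <=
         c2 * INR #|A| ^ 4 * Rpower (INR #|S_ G (diffset C C)|) (2 / 3)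
           * ln (INR #|A|))%R).
Proof.
split.
  pose K := (21 * INR energy_const)%R.
  have K0 : (0 < K)%R.
    by apply: Rmult_lt_0_compat; [lra|apply: lt_0_INR; rewrite /energy_const; lia].
  exists (K ^ 2)%R; split; first exact: pow_lt.
  move=> p pp A G C D xi eta s sgA sgG Ap _ _ xi0 eta0 CA DA C3 CDG.
  have := triples_bound pp sgA sgG Ap xi0 eta0 CA DA C3 CDG.
  have := leq_INR (ratios_energy C sgG).
  rewrite INRX !INRM -/K.
  have := pos_INR #|C|; have := pos_INR #|D|; have := pos_INR #|G|; have := pos_INR #|A|.
  move: (ln (INR #|A|)) => q.
  move: (INR #|ratios G C|) (INR #|S_ _ _|) (INR (add_energy G)) (INR #|A|).
  move: (INR #|G|) (INR #|D|) (INR #|C|) => g d c l S E a a0 g0 d0 c0 hE h.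
  (* Squaring produces [l ^ 2], which after multiplication by [g ^ 2] is bounded by
     [ratios_energy]. *)
  have {}h : ((c ^ 4 * d ^ 2) ^ 2 <= (K * (l * (a ^ 4 * q))) ^ 2)%R.
    by apply: pow_incr; split=> //; apply: Rmult_le_pos; apply: pow_le.
  have {}h : ((c ^ 4 * d ^ 2) ^ 2 * g ^ 2 <= (K * (l * (a ^ 4 * q))) ^ 2 * g ^ 2)%R.
    by apply: Rmult_le_compat_r => //; apply: pow_le.
  have -> : (c ^ 8 * d ^ 4 * g ^ 2 = (c ^ 4 * d ^ 2) ^ 2 * g ^ 2)%R by ring.
  apply: (Rle_trans _ _ _ h).
  have -> : ((K * (l * (a ^ 4 * q))) ^ 2 * g ^ 2
            = K ^ 2 * a ^ 8 * q ^ 2 * (g * l) ^ 2)%R by ring.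
  have -> : (K ^ 2 * a ^ 8 * S * E * q ^ 2 = K ^ 2 * a ^ 8 * q ^ 2 * (S * E))%R by ring.
  apply: Rmult_le_compat_l hE.
  by apply: Rmult_le_pos (pow2_ge_0 _); apply: Rmult_le_pos; [exact: pow2_ge_0|exact: pow_le].
(* No loss is needed in the exponent [3/5]: Stepanov's bound only requires
   [|G|^9 <= p^6], which leaves room up to [p^(2/3)]. *)
exists (fun=> 0%R); split.
  by move=> e e0; exists 0%N => n _; rewrite R_dist_eq.
move=> c1 c10; pose K := (21 * INR energy_const)%R.
have K0 : (0 < K)%R.
  by apply: Rmult_lt_0_compat; [lra|apply: lt_0_INR; rewrite /energy_const; lia].
have c15 : (0 < 100 + c1 ^ 15)%R by have := pow_lt c1 15 c10; lra.
exists (K * (100 + c1 ^ 15))%R; split; first exact: Rmult_lt_0_compat.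
move=> p pp A G C D xi eta s sgA sgG Ap _ _ xi0 eta0 CA DA C3 CDG.
rewrite Rminus_0_r => Gp.
have hL := ratios_le_orbit pp sgG C3 c10 Gp.
have h := triples_bound pp sgA sgG Ap xi0 eta0 CA DA C3 CDG.
have ln1 : (1 <= ln (INR #|A|))%R.
  by apply: one_le_ln; have := leq_INR (card_A_ge3 CA C3); rewrite /=; lra.
apply: (Rle_trans _ _ _ h); rewrite -/K.
have a0 : (0 <= INR #|A| ^ 4 * ln (INR #|A|))%R.
  by apply: Rmult_le_pos; [apply: pow_le; apply: pos_INR|lra].
have := Rmult_le_compat_r _ _ _ a0 hL.
move/(Rmult_le_compat_l K _ _ (Rlt_le _ _ K0)); rewrite -/K; lra.
Qed.
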